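(* Let $\alpha>0$ and let $b_0\in\mathbb{R}^3\setminus\{0\}$. Consider on the sphere $S^2$ the Landau-Lifshitz equation $\frac{d\mu}{dt}=-\mu\wedge b_0-\alpha\,\mu\wedge(\mu\wedge b_0)$ and its $b_t$-RODE stochastisation $$\frac{d\mu}{dt}=-\mu\wedge b_t(\omega)-\alpha\,\mu\wedge(\mu\wedge b_t(\omega)).$$ The equilibrium points of the Landau-Lifshitz equation are preserved by the $b_t$-RODE stochastisation if and only if $b_t$ is of the form $b_0\eta_t$ where $\eta_t$ is a real valued bounded stochastic process. The equilibrium points are then given by $\pm b_0/\|b_0\|$.
   Context: $\wedge$ is the vector cross product in $\mathbb{R}^3$, $S^2$ the unit sphere in $\mathbb{R}^3$. $b_t$ is an $\mathbb{R}^3$-valued stochastic process with continuous sample paths on a probability space; the effective field is assumed to be non zero. The RODE (random ordinary differential equation) is interpreted pathwise, for almost every realization $\omega$. A point $\mu\in S^2$ is an equilibrium point of the RODE if the right-hand side vanishes at $\mu$ for all $t$ and (almost) all $\omega$. The equilibrium points on $S^2$ of the deterministic Landau-Lifshitz equation with effective field $b_0$ are $\pm b_0/\|b_0\|$.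
   Formalization: As stated ''only if'' fails (b_t=(1+t)b_0 gives unbounded η_t); proved with ''bounded'' read as pathwise bounded on finite time intervals, and with uniformly bounded η_t when b_t is uniformly bounded; the last sentence assumes b_t is not almost surely identically zero. *)

(* Defs.v *)
From HB Require Import structures.
From mathcomp Require Import all_boot all_order all_algebra.
From mathcomp Require Import all_classical all_reals all_analysis.

Set Implicit Arguments.
Unset Strict Implicit.
Unset Printing Implicit Defensive.

Import Order.TTheory GRing.Theory Num.Theory.
Import numFieldNormedType.Exports.

Local Open Scope classical_set_scope.
Local Open Scope ring_scope.

(* Coordinates are indexed by 'I_3 with its arithmetic modulo 3, so that
   i + 1 and i + 2 are the two cyclic successors of i. *)
Definition crossmul (R : realType) (u v : 'rV[R]_3) : 'rV[R]_3 :=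
  \row_i (u 0 (i + 1) * v 0 (i + 2) - u 0 (i + 2) * v 0 (i + 1)).

(* The norm `|v| provided by the library on 'rV[R]_3 is the sup norm. *)
Definition enorm (R : realType) (v : 'rV[R]_3) : R :=
  Num.sqrt (\sum_i v 0 i ^+ 2).

Definition sphere2 (R : realType) : set 'rV[R]_3 := [set v | enorm v = 1].
Arguments sphere2 {R}.

(* Right-hand side of the Landau-Lifshitz equation with effective field b. *)
Definition LL_field (R : realType) (alpha : R) (b mu : 'rV[R]_3) : 'rV[R]_3 :=
  - crossmul mu b - alpha *: crossmul mu (crossmul mu b).

Definition LL_equilibrium (R : realType) (alpha : R) (b0 mu : 'rV[R]_3) : Prop :=
  sphere2 mu /\ LL_field alpha b0 mu = 0.

(* Processes are functions of time t : R and of the sample point; only times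
   t >= 0 are ever considered.  The Borel sigma-algebra of R^3 being the product
   one, measurability of a random vector is that of its coordinates. *)
Definition process (d : measure_display) (T : measurableType d) (R : realType)
    (X : R -> T -> R) : Prop :=
  forall t, 0 <= t -> measurable_fun setT (X t).

Definition vprocess (d : measure_display) (T : measurableType d) (R : realType)
    (X : R -> T -> 'rV[R]_3) : Prop :=
  forall i : 'I_3, process (fun t w => X t w 0 i).

Definition continuous_paths (T : Type) (R : realType)
    (X : R -> T -> 'rV[R]_3) : Prop :=
  forall w, {within `[0, +oo[, continuous (fun t => X t w)}.

(* Uniform boundedness: a single deterministic bound for all times and almost
   all realizations. *)
Definition bounded_process (d : measure_display) (T : measurableType d)
    (R : realType) (P : probability T R) (X : R -> T -> R) : Prop :=
  exists M : R, {ae P, forall w, forall t, 0 <= t -> `|X t w| <= M}.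

(* Pathwise boundedness: almost every path is bounded on each finite time
   interval, with a bound that may depend on the path. *)
Definition pathwise_bounded_process (d : measure_display)
    (T : measurableType d) (R : realType) (P : probability T R)
    (X : R -> T -> R) : Prop :=
  {ae P, forall w, forall s, exists M : R,
     forall t, 0 <= t <= s -> `|X t w| <= M}.

Definition RODE_equilibrium (d : measure_display) (T : measurableType d)
    (R : realType) (P : probability T R) (alpha : R)
    (b : R -> T -> 'rV[R]_3) (mu : 'rV[R]_3) : Prop :=
  sphere2 mu /\
  {ae P, forall w, forall t, 0 <= t -> LL_field alpha (b t w) mu = 0}.

Definition equilibria_preserved (d : measure_display) (T : measurableType d)
    (R : realType) (P : probability T R) (alpha : R) (b0 : 'rV[R]_3)
    (b : R -> T -> 'rV[R]_3) : Prop :=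
  forall mu, LL_equilibrium alpha b0 mu -> RODE_equilibrium P alpha b mu.

(* b_t = b0 eta_t, pathwise for almost every realization. *)
Definition of_form (d : measure_display) (T : measurableType d)
    (R : realType) (P : probability T R) (b : R -> T -> 'rV[R]_3)
    (b0 : 'rV[R]_3) (eta : R -> T -> R) : Prop :=
  {ae P, forall w, forall t, 0 <= t -> b t w = eta t w *: b0}.

(* Main.v *)
Require Import Defs.
From HB Require Import structures.
From mathcomp Require Import all_boot all_order all_algebra.
From mathcomp Require Import all_classical all_reals all_analysis.
From mathcomp Require Import measurable_realfun ring.

Set Implicit Arguments.
Unset Strict Implicit.
Unset Printing Implicit Defensive.

Import Order.TTheory GRing.Theory Num.Theory.
Import numFieldNormedType.Exports.

Local Open Scope classical_set_scope.
Local Open Scope ring_scope.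

(** Write [c] for [crossmul mu b].  The two terms of the Landau-Lifshitz field
    are [- c] and [- alpha *: crossmul mu c]; the second one is orthogonal to
    [c], so pairing a vanishing field with [c] gives [dot c c = 0].  Hence an
    equilibrium is a unit vector with zero cross product with the field
    ([LL_field_eq0]), and the expansion of the double cross product
    turns this into [b = dot mu b *: mu] ([crossmul_eq0_collinear]).

    Apply this at [mu = (enorm b0)^-1 *: b0], which is an equilibrium for [b0].
    If it remains one for [b t w] at all times, then [b t w = eta t w *: b0],
    where [eta] is the coefficient of [b] along [b0] ([coef_along]).  This [eta]
    is linear in [b], so it inherits measurability and the continuity of paths,
    and compactness bounds every path on every finite interval
    ([coef_along_pathwise_bounded]); since [enorm (b t w)] equals
    [`|eta t w| * enorm b0], a uniform bound for the norm of [b] gives one for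
    [eta].  Conversely a multiple of [b0] has zero cross product with every
    vector for which [b0] does.

    Finally, suppose that [mu] is an equilibrium of the equation driven by
    [eta t w *: b0].  If the cross product of [mu] and [b0] were nonzero, [eta]
    would vanish at all times almost surely, and so would [b].  Outside this
    degenerate case [mu] is therefore an equilibrium for [b0], that is, one of
    the two unit vectors collinear to [b0] ([LL_equilibriumP]). *)

(** * Euclidean geometry of the cross product *)

Definition dot (R : realType) (u v : 'rV[R]_3) : R := \sum_i u 0 i * v 0 i.

(** Expanding the sum from an arbitrary index, rather than from [0], lets the
    cyclic coordinates of a cross product be treated uniformly in [i]. *)
Lemma sum_cyclic3 (V : nmodType) (F : 'I_3 -> V) (i : 'I_3) :
  \sum_j F j = F i + F (i + 1) + F (i + 2).
Proof.
rewrite !big_ord_recl big_ord0 addr0 addrA.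
have -> : lift ord0 ord0 = 1 :> 'I_3 by apply/val_inj.
have -> : lift ord0 (lift ord0 ord0) = 2 :> 'I_3 by apply/val_inj.
have -> : ord0 = 0 :> 'I_3 by apply/val_inj.
have [->|->|->] : [\/ i = 0, i = 1 | i = 2].
- case: i => [[|[|[|//]]] ?].
  + by constructor 1; apply/val_inj.
  + by constructor 2; apply/val_inj.
  + by constructor 3; apply/val_inj.
- by rewrite !add0r.
- have -> : 1 + 1 = 2 :> 'I_3 by apply/val_inj.
  have -> : 1 + 2 = 0 :> 'I_3 by apply/val_inj.
  by rewrite -addrA addrC.
- have -> : 2 + 1 = 0 :> 'I_3 by apply/val_inj.
  have -> : 2 + 2 = 1 :> 'I_3 by apply/val_inj.
  by rewrite addrC addrA addrAC addrC addrA addrAC.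
Qed.

Lemma addI3E (i : 'I_3) :
  [/\ i + 1 + 1 = i + 2, i + 1 + 2 = i, i + 2 + 1 = i & i + 2 + 2 = i + 1].
Proof. by split; apply/val_inj; case: i => [[|[|[|//]]] ?]. Qed.

Section Vectors.
Variable R : realType.
Implicit Types (u v mu b : 'rV[R]_3) (a alpha : R).

Lemma dotC u v : dot u v = dot v u.
Proof. by apply: eq_bigr => i _; rewrite mulrC. Qed.

Lemma dotZr a u v : dot u (a *: v) = a * dot u v.
Proof. by rewrite mulr_sumr; apply: eq_bigr => i _; rewrite mxE mulrCA. Qed.

Lemma dotNr u v : dot u (- v) = - dot u v.
Proof. by rewrite -scaleN1r dotZr mulN1r. Qed.

Lemma dotDr u v w : dot u (v + w) = dot u v + dot u w.
Proof. by rewrite -big_split; apply: eq_bigr => i _; rewrite mxE mulrDr. Qed.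

Lemma dotxx_ge0 u : 0 <= dot u u.
Proof. by apply: sumr_ge0 => i _; rewrite -expr2 sqr_ge0. Qed.

Lemma dotxx_eq0 u : (dot u u == 0) = (u == 0).
Proof.
apply/idP/eqP => [|->]; last by rewrite /dot big1 // => i _; rewrite mxE mul0r.
rewrite psumr_eq0 => [/allP u0|i _]; last by rewrite -expr2 sqr_ge0.
apply/rowP => i; rewrite mxE; apply/eqP.
by have := u0 i (mem_index_enum i); rewrite -expr2 sqrf_eq0.
Qed.

Lemma enormE u : enorm u = Num.sqrt (dot u u).
Proof. by congr Num.sqrt; apply: eq_bigr => i _; rewrite expr2. Qed.

Lemma sqr_enorm u : enorm u ^+ 2 = dot u u.
Proof. by rewrite enormE sqr_sqrtr ?dotxx_ge0. Qed.

Lemma enorm_gt0 u : u != 0 -> 0 < enorm u.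
Proof. by move=> u0; rewrite enormE sqrtr_gt0 lt0r dotxx_eq0 u0 dotxx_ge0. Qed.

Lemma enormZ a u : enorm (a *: u) = `|a| * enorm u.
Proof.
by rewrite !enormE dotZr dotC dotZr mulrA -expr2 sqrtrM ?sqr_ge0 // sqrtr_sqr.
Qed.

Lemma crossmulZr a u v : crossmul u (a *: v) = a *: crossmul u v.
Proof. by apply/rowP => i; rewrite !mxE; ring. Qed.

Lemma crossmulZl a u v : crossmul (a *: u) v = a *: crossmul u v.
Proof. by apply/rowP => i; rewrite !mxE; ring. Qed.

Lemma crossmulv0 u : crossmul u 0 = 0.
Proof. by apply/rowP => i; rewrite !mxE; ring. Qed.

Lemma crossmulvv u : crossmul u u = 0.
Proof. by apply/rowP => i; rewrite !mxE; ring. Qed.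

Lemma dot_crossmulr u v : dot v (crossmul u v) = 0.
Proof.
rewrite /dot (sum_cyclic3 _ 0) !mxE.
by have [-> -> -> ->] := addI3E 0; ring.
Qed.

Lemma crossmul_crossmul u v :
  crossmul u (crossmul u v) = dot u v *: u - dot u u *: v.
Proof.
apply/rowP => i; rewrite /dot !(sum_cyclic3 _ i) !mxE.
by have [-> -> -> ->] := addI3E i; ring.
Qed.

Lemma crossmul_eq0_collinear mu b :
  enorm mu = 1 -> crossmul mu b = 0 -> b = dot mu b *: mu.
Proof.
move=> mu1 mub0; have := crossmul_crossmul mu b.
rewrite mub0 crossmulv0 -sqr_enorm mu1 expr1n scale1r.
by move/esym/eqP; rewrite subr_eq0 => /eqP.
Qed.

(** The damping term is orthogonal to the precession term, so they cannot
    cancel each other. *)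
Lemma LL_field_eq0 alpha b mu :
  LL_field alpha b mu = 0 <-> crossmul mu b = 0.
Proof.
rewrite /LL_field; set c := crossmul mu b; split => [fld0|->]; last first.
  by rewrite crossmulv0 scaler0 oppr0 addr0.
have : dot c (- c - alpha *: crossmul mu c) = 0.
  by rewrite fld0 /dot big1 // => i _; rewrite [X in _ * X]mxE mulr0.
rewrite dotDr !dotNr dotZr dot_crossmulr mulr0 subr0 => /eqP.
by rewrite oppr_eq0 dotxx_eq0 => /eqP.
Qed.

Lemma LL_equilibriumP alpha b mu : b != 0 ->
  LL_equilibrium alpha b mu <->
  mu = (enorm b)^-1 *: b \/ mu = - ((enorm b)^-1 *: b).
Proof.
move=> /enorm_gt0 b_gt0; have b_neq0 := lt0r_neq0 b_gt0.
split=> [[mu1 /LL_field_eq0 mub]|mu_b].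
  have bE := crossmul_eq0_collinear mu1 mub.
  have := enormZ (dot mu b) mu; rewrite mu1 mulr1 -bE => nb.
  (* The coefficient of b along mu is the norm of b up to sign. *)
  have [|] : dot mu b = enorm b \/ dot mu b = - enorm b.
    by rewrite nb; case: (ger0P (dot mu b)) => _; [left|right; rewrite opprK].
    by move=> e; left; rewrite {2}bE e scalerA mulVf ?scale1r.
  by move=> e; right; rewrite {2}bE e scalerA mulrN mulVf // scaleN1r opprK.
have [a -> a1] : exists2 a, mu = a *: b & `|a| = (enorm b)^-1.
  by case: mu_b => ->; [exists (enorm b)^-1|exists (- (enorm b)^-1)];
    rewrite ?scaleNr ?normrN ?gtr0_norm ?invr_gt0.
split; first by rewrite /sphere2/= enormZ a1 mulVf.
by apply/LL_field_eq0; rewrite crossmulZl crossmulvv scaler0.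
Qed.

End Vectors.

(** * The coefficient of the field along a fixed vector *)

Section Coefficient.
Context {R : realType} {d : measure_display} {T : measurableType d}.
Variables (b0 : 'rV[R]_3) (b : R -> T -> 'rV[R]_3).

Definition coef_along (t : R) (w : T) : R := (dot b0 b0)^-1 * dot b0 (b t w).

Lemma coef_along_process : vprocess b -> process coef_along.
Proof.
move=> hb t t0; apply: measurable_funM => //.
apply: measurable_sum => i; apply: measurable_funM => //.
exact: hb.
Qed.

(** Each path is continuous on a compact interval; the bound depends on the
    path. *)
Lemma coef_along_pathwise_bounded (P : probability T R) :
  continuous_paths b -> pathwise_bounded_process P coef_along.
Proof.
move=> hbc; apply: aeW => w s.
have [s_lt0|s_ge0] := ltP s 0.
  by exists 0 => t /andP[/le_trans/[apply]]; rewrite leNgt s_lt0.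
have cont : {within `[0, +oo[, continuous (fun t => coef_along t w)}.
  move=> t; apply: cvgM; first exact: cvg_cst.
  apply: (cvg_big add_continuous) => i _; apply: cvgM; first exact: cvg_cst.
  apply: (@cvg_comp _ _ _ (fun t => b t w) (fun v : 'rV[R]_3 => v 0 i)).
    exact: (hbc w t).
  exact: coord_continuous.
have sub : `[0, s] `<=` (`[0, +oo[ : set R) by apply: subset_itvl.
have {}cont := continuous_subspaceW sub cont.
have := compact_bounded (continuous_compact cont (@segment_compact _ 0 s)).
case=> M [_ /(_ (M + 1))]; rewrite ltrDl ltr01 => /(_ isT) bnd.
by exists (M + 1) => t ts; apply: bnd; exists t; rewrite //= in_itv.
Qed.

End Coefficient.

(** * Preservation of the equilibria *)

Section Preservation.
Context {R : realType} {d : measure_display} {T : measurableType d}.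
Variables (P : probability T R) (alpha : R).
Variables (b0 : 'rV[R]_3) (b : R -> T -> 'rV[R]_3).
Implicit Types (mu : 'rV[R]_3) (eta : R -> T -> R).

(** Testing the preservation on a single equilibrium already forces the field
    to be collinear to [b0]. *)
Lemma equilibria_preserved_of_form : b0 != 0 ->
  equilibria_preserved P alpha b0 b -> of_form P b b0 (coef_along b0 b).
Proof.
move=> b0_neq0 /(_ ((enorm b0)^-1 *: b0)) pres.
have [|mu1] := pres; first by apply/(LL_equilibriumP alpha _ b0_neq0); left.
apply: filterS => w eqw t t0.
have /LL_field_eq0/(crossmul_eq0_collinear mu1) bE := eqw t t0.
rewrite {1}bE dotC dotZr dotC scalerA /coef_along -sqr_enorm.
by rewrite -exprVn expr2 mulrAC.
Qed.

Lemma of_form_equilibria_preserved eta :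
  of_form P b b0 eta -> equilibria_preserved P alpha b0 b.
Proof.
move=> form mu [mu1 /LL_field_eq0 mub0]; split=> //.
apply: filterS form => w bE t t0.
by apply/LL_field_eq0; rewrite bE // crossmulZr mub0 scaler0.
Qed.

Lemma of_form_bounded eta : b0 != 0 -> of_form P b b0 eta ->
  bounded_process P (fun t w => enorm (b t w)) -> bounded_process P eta.
Proof.
move=> /enorm_gt0 b0_gt0 form [M bM]; exists (M / enorm b0).
apply: filterS2 form bM => w bE bM t t0.
rewrite ler_pdivlMr // -enormZ -bE //.
exact: le_trans (ler_norm _) (bM t t0).
Qed.

(** A unit vector not collinear to [b0] is an equilibrium for [eta t w *: b0]
    only at the times where [eta] vanishes. *)
Lemma of_form_RODE_equilibrium eta mu :
  of_form P b b0 eta -> ~ {ae P, forall w, forall t, 0 <= t -> b t w = 0} ->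
  RODE_equilibrium P alpha b mu -> LL_equilibrium alpha b0 mu.
Proof.
move=> form bn0 [mu1 eqmu]; split=> //; apply/LL_field_eq0.
apply: contrapT => /eqP mub0; apply: bn0.
apply: filterS2 form eqmu => w bE eqw t t0.
have /LL_field_eq0/eqP := eqw t t0.
rewrite bE // crossmulZr scaler_eq0 (negPf mub0) orbF => /eqP ->.
by rewrite scale0r.
Qed.

End Preservation.

Theorem lemma7p14 (R : realType) (d : measure_display) (T : measurableType d)
    (P : probability T R) (alpha : R) (b0 : 'rV[R]_3) (b : R -> T -> 'rV[R]_3)
    (halpha : 0 < alpha) (hb0 : b0 != 0)
    (hb : vprocess b) (hbc : continuous_paths b) :
  [/\ equilibria_preserved P alpha b0 b <->
        (exists eta : R -> T -> R,
           [/\ process eta, pathwise_bounded_process P eta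
             & of_form P b b0 eta]),
      bounded_process P (fun t w => enorm (b t w)) ->
        (equilibria_preserved P alpha b0 b <->
         (exists eta : R -> T -> R,
            [/\ process eta, bounded_process P eta & of_form P b b0 eta]))
    & ~ {ae P, forall w, forall t, 0 <= t -> b t w = 0} ->
        equilibria_preserved P alpha b0 b ->
        forall mu : 'rV[R]_3,
          RODE_equilibrium P alpha b mu <->
          mu = (enorm b0)^-1 *: b0 \/ mu = - ((enorm b0)^-1 *: b0)].
Proof.
have form := @equilibria_preserved_of_form _ _ _ P alpha b0 b hb0.
have eta_proc := coef_along_process b0 hb.
split.
- split=> [/form bE|[eta [_ _]]]; last exact: of_form_equilibria_preserved.
  exists (coef_along b0 b); split=> //.
  exact: coef_along_pathwise_bounded.
- move=> bM; split=> [/form bE|[eta [_ _]]];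
    last exact: of_form_equilibria_preserved.
  by exists (coef_along b0 b); split=> //; exact: of_form_bounded bE bM.
- move=> bn0 pres mu; rewrite -(LL_equilibriumP alpha _ hb0); split.
    exact: of_form_RODE_equilibrium (form pres) bn0.
  exact: pres.
Qed.
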